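(* Let $(T_n)_{n\ge 0}$ be the Tribonacci sequence, $T_0=0$, $T_1=1$, $T_2=1$, $T_{n+3}=T_{n+2}+T_{n+1}+T_n$ for $n\ge 0$. Let $\{x_n,y_n\}_{n\ge -1}$ be a well defined solution of the system $$x_{n+1}=\frac{y_nx_{n-1}+x_{n-1}+1}{y_nx_{n-1}},\qquad y_{n+1}=\frac{x_ny_{n-1}+y_{n-1}+1}{x_ny_{n-1}},\qquad n=0,1,\ldots.$$ Then, for $n=0,1,2,\ldots$, $$x_{2n+1}=\frac{T_{2n+1}+(T_{2n+3}-T_{2n+2})x_{-1}+T_{2n+2}x_{-1}y_0}{T_{2n}+(T_{2n+2}-T_{2n+1})x_{-1}+T_{2n+1}x_{-1}y_0},$$ $$x_{2n+2}=\frac{T_{2n+2}+(T_{2n+4}-T_{2n+3})y_{-1}+T_{2n+3}x_0y_{-1}}{T_{2n+1}+(T_{2n+3}-T_{2n+2})y_{-1}+T_{2n+2}x_0y_{-1}},$$ $$y_{2n+1}=\frac{T_{2n+1}+(T_{2n+3}-T_{2n+2})y_{-1}+T_{2n+2}x_0y_{-1}}{T_{2n}+(T_{2n+2}-T_{2n+1})y_{-1}+T_{2n+1}x_0y_{-1}},$$ $$y_{2n+2}=\frac{T_{2n+2}+(T_{2n+4}-T_{2n+3})x_{-1}+T_{2n+3}x_{-1}y_0}{T_{2n+1}+(T_{2n+3}-T_{2n+2})x_{-1}+T_{2n+2}x_{-1}y_0}.$$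
   Context: All quantities are real. A solution $\{x_n,y_n\}_{n\ge -1}$ of the system is called well defined if $x_ny_n\neq 0$ for all $n=-1,0,1,\ldots$ (so that every step of the recursion makes sense). *)

(* Defs.v *)
From mathcomp Require Import all_boot all_order all_algebra.
From mathcomp Require Import reals.

Set Implicit Arguments.
Unset Strict Implicit.
Unset Printing Implicit Defensive.

Import Order.TTheory GRing.Theory Num.Theory.

Fixpoint tribonacci (n : nat) : nat :=
  match n with
  | 0 => 0
  | 1 => 1
  | 2 => 1
  | ((n0.+1 as n1).+1 as n2).+1 =>
      tribonacci n2 + tribonacci n1 + tribonacci n0
  end.

Local Open Scope ring_scope.

(* Sequences indexed by n >= -1 are functions on int; nothing is required of
   their values at indices below -1. *)
Definition is_solution (R : realType) (x y : int -> R) : Prop :=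
  forall n : int, 0 <= n ->
    x (n + 1) = (y n * x (n - 1) + x (n - 1) + 1) / (y n * x (n - 1)) /\
    y (n + 1) = (x n * y (n - 1) + y (n - 1) + 1) / (x n * y (n - 1)).

(* This makes every division in the recursion a genuine one. It also means that
   a closed form [x n = a / b] with n >= -1 forces [b != 0], since [a / 0 = 0]. *)
Definition well_defined (R : realType) (x y : int -> R) : Prop :=
  forall n : int, -1 <= n -> x n * y n != 0.

(* Main.v *)
(* Put w_k = z_{-1} z_0 ... z_k, where z is one of the interleaved sequences
   x_{-1}, y_0, x_1, y_2, ... and y_{-1}, x_0, y_1, x_2, ....  The system says
   z_{k+1} = 1 + 1/z_k + 1/(z_k z_{k-1}), that is
   w_{k+1} = w_k + w_{k-1} + w_{k-2}.  Hence w is a combination of Tribonacci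
   numbers, and z_{k+1} = w_{k+1} / w_k. *)
Require Import Defs.
From mathcomp Require Import all_boot all_order all_algebra.
From mathcomp Require Import reals.
From mathcomp Require Import ring.

Import Order.TTheory GRing.Theory Num.Theory.
Local Open Scope ring_scope.

Lemma tribonacciS3 n :
  tribonacci n.+3 = (tribonacci n.+2 + tribonacci n.+1 + tribonacci n)%N.
Proof. by []. Qed.

Section TribonacciRatio.

Variables (F : fieldType) (z : nat -> F).
Hypothesis z_neq0 : forall k, z k != 0.
Hypothesis zSS : forall k,
  z k.+2 = (z k.+1 * z k + z k + 1) / (z k.+1 * z k).

Let T (k : nat) : F := (tribonacci k)%:R.
Let w (k : nat) : F := \prod_(i < k) z i.
(** The Tribonacci recurrence solved with initial values [w 0 = 1], [w 1 = z 0], [w 2 = z 0 * z 1],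
    read two places later. *)
Let D (k : nat) : F := T k + (T k.+2 - T k.+1) * z 0 + T k.+1 * z 0 * z 1.

(** As [w k.+2] contains the factor [z k.+1 * z k], multiplying it by [z k.+2] cancels the
    denominator. *)
Let wS3 k : w k.+3 = w k.+2 + w k.+1 + w k.
Proof.
rewrite /w !big_ord_recr /= zSS; field.
by rewrite !z_neq0.
Qed.

Let TS3 k : T k.+3 = T k.+2 + T k.+1 + T k.
Proof. by rewrite /T tribonacciS3 !natrD. Qed.

Let D_prod k : D k = w k.+2.
Proof.
(* The recurrence has order three, so the induction carries three consecutive values. *)
suff: [/\ D k = w k.+2, D k.+1 = w k.+3 & D k.+2 = w k.+4] by case.
elim: k => [|k [Dk Dk1 Dk2]].
  have T0 : T 0 = 0 by [].
  have T1 : T 1 = 1 by [].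
  have T2 : T 2 = 1 by [].
  (* [wS3] reduces [w 3] and [w 4] to polynomials in [z 0] and [z 1], which leaves no division. *)
  by split; rewrite /D ?wS3 /w !big_ord_recr big_ord0 /= ?TS3 T0 T1 T2; ring.
split=> //; rewrite wS3 -Dk -Dk1 -Dk2 /D !TS3; ring.
Qed.

Lemma tribonacci_ratio k : z k.+2 = D k.+1 / D k.
Proof.
have w_neq0 : w k.+2 != 0 by apply/prodf_neq0 => i _; apply: z_neq0.
by rewrite !D_prod [w k.+3]big_ord_recr /= mulrAC mulfV // mul1r.
Qed.

End TribonacciRatio.

Lemma interleaved_ratio (R : realType) (x y : int -> R) (n : nat) :
  is_solution x y -> well_defined x y ->
  let T (k : nat) : R := (tribonacci k)%:R in
  let D k := T k + (T k.+2 - T k.+1) * x (-1) + T k.+1 * x (-1) * y 0 in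
  x n.*2.+1%:Z = D n.*2.+1 / D n.*2 /\ y n.*2.+2%:Z = D n.*2.+2 / D n.*2.+1.
Proof.
move=> hsol hwd T D.
(* The shift by one puts [x (-1)] at [z 0] and [y 0] at [z 1]. *)
pose z k := if odd k then y (k%:Z - 1) else x (k%:Z - 1).
have z_neq0 k : z k != 0.
  have : x (k%:Z - 1) * y (k%:Z - 1) != 0 by apply: hwd; rewrite lerBrDr.
  by rewrite mulf_eq0 negb_or /z => /andP[? ?]; case: ifP.
have predE k : k.+1%:Z - 1 = k%:Z by rewrite -[k.+1]addn1 PoszD addrK.
have zSS k : z k.+2 = (z k.+1 * z k + z k + 1) / (z k.+1 * z k).
  have [] := hsol k%:Z isT.
  have -> : k%:Z + 1 = k.+1%:Z by rewrite -[k.+1]addn1.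
  (* The parity of [k] selects the equation: the one for [y] if [k] is odd, the one for [x] if it is
     even. *)
  by rewrite /z /= negbK !predE; case: (odd k).
have ratio := tribonacci_ratio _ _ z_neq0 zSS.
have := (ratio n.*2, ratio n.*2.+1).
by rewrite /z /= !odd_double /= !predE => -[-> ->].
Qed.

Theorem corollary3 (R : realType) (x y : int -> R)
    (hsol : is_solution x y) (hwd : well_defined x y) (n : nat) :
  let T (k : nat) : R := (tribonacci k)%:R in
  [/\ x (2 * n + 1)%N%:Z =
        (T (2 * n + 1)%N + (T (2 * n + 3)%N - T (2 * n + 2)%N) * x (-1)
           + T (2 * n + 2)%N * x (-1) * y 0)
        / (T (2 * n)%N + (T (2 * n + 2)%N - T (2 * n + 1)%N) * x (-1)
           + T (2 * n + 1)%N * x (-1) * y 0),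
      x (2 * n + 2)%N%:Z =
        (T (2 * n + 2)%N + (T (2 * n + 4)%N - T (2 * n + 3)%N) * y (-1)
           + T (2 * n + 3)%N * x 0 * y (-1))
        / (T (2 * n + 1)%N + (T (2 * n + 3)%N - T (2 * n + 2)%N) * y (-1)
           + T (2 * n + 2)%N * x 0 * y (-1)),
      y (2 * n + 1)%N%:Z =
        (T (2 * n + 1)%N + (T (2 * n + 3)%N - T (2 * n + 2)%N) * y (-1)
           + T (2 * n + 2)%N * x 0 * y (-1))
        / (T (2 * n)%N + (T (2 * n + 2)%N - T (2 * n + 1)%N) * y (-1)
           + T (2 * n + 1)%N * x 0 * y (-1))
    & y (2 * n + 2)%N%:Z =
        (T (2 * n + 2)%N + (T (2 * n + 4)%N - T (2 * n + 3)%N) * x (-1)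
           + T (2 * n + 3)%N * x (-1) * y 0)
        / (T (2 * n + 1)%N + (T (2 * n + 3)%N - T (2 * n + 2)%N) * x (-1)
           + T (2 * n + 2)%N * x (-1) * y 0)].
Proof.
move=> T.
(* The system is invariant under exchanging [x] and [y], so the second interleaving needs no
   separate argument. *)
have swap (u v : int -> R) : is_solution u v -> is_solution v u.
  by move=> h k /h[].
have hwd' : well_defined y x by move=> k /hwd; rewrite mulrC.
have [x_odd y_even] := interleaved_ratio _ _ _ n hsol hwd.
have [y_odd x_even] := interleaved_ratio _ _ _ n (swap _ _ hsol) hwd'.
rewrite !mul2n !addnS !addn0 x_odd y_even y_odd x_even.
(* After the exchange the last term has [y (-1)] before [x 0], the reverse of the goal. *)
by split; rewrite // ![_ * x 0 * _]mulrAC.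
Qed.
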